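(* Let $s>0$ be an odd integer. There is a bijection between the set of $(s,s+2)$-core partitions with distinct parts and the set of lattice paths of length $s$ from $(0,0)$ to $(s,y)$, where $y$ ranges over the positive integers.
   Context: A partition $\lambda=(\lambda_1,\dots,\lambda_\ell)$ is a weakly decreasing tuple of positive integers. In its Ferrers diagram, the hook length of a cell is the number of cells to its right in its row, plus the number of cells below it in its column, plus $1$. A partition is an $a$-core if none of its hook lengths is divisible by $a$; it is an $(a,b)$-core if it is both an $a$-core and a $b$-core. A partition has distinct parts if all its parts $\lambda_1,\dots,\lambda_\ell$ are pairwise different. A lattice path of length $n$ is a path in $\mathbb{Z}\times\mathbb{Z}$ from $(0,0)$ to $(n,y)$ for some $y\in\mathbb{Z}$ using up steps $U=(1,1)$ and down steps $D=(1,-1)$. *)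

(* Defs.v *)
From HB Require Import structures.
From mathcomp Require Import all_boot all_order all_algebra.
From mathcomp Require Import classical_sets functions.

Set Implicit Arguments.
Unset Strict Implicit.
Unset Printing Implicit Defensive.

Import Order.TTheory GRing.Theory Num.Theory.

Local Open Scope nat_scope.

Definition is_partition (la : seq nat) : bool :=
  sorted geq la && all (ltn 0) la.

(* Cells are pairs (row, column), both numbered from 0, rows going down. *)
Definition ferrers (la : seq nat) : seq (nat * nat) :=
  [seq (i, j) | i <- iota 0 (size la), j <- iota 0 (nth 0 la i)].

Definition arm (la : seq nat) (c : nat * nat) : nat :=
  count (fun d : nat * nat => (d.1 == c.1) && (c.2 < d.2)) (ferrers la).

Definition leg (la : seq nat) (c : nat * nat) : nat :=
  count (fun d : nat * nat => (d.2 == c.2) && (c.1 < d.1)) (ferrers la).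

Definition hook_length (la : seq nat) (c : nat * nat) : nat :=
  arm la c + leg la c + 1.

Definition is_core (a : nat) (la : seq nat) : bool :=
  all (fun c => ~~ (a %| hook_length la c)) (ferrers la).

Definition distinct_parts (la : seq nat) : bool := uniq la.

Definition core_distinct (a b : nat) : set (seq nat) :=
  [set la | [/\ is_partition la, is_core a la, is_core b la
              & distinct_parts la]]%classic.

Local Open Scope ring_scope.

Definition lattice_step (P Q : int * int) : bool :=
  (Q == P + (1, 1)) || (Q == P + (1, -1)).

(* A path is given by the sequence p of the points visited after the origin. *)
Definition is_lattice_path (n : nat) (y : int) (p : seq (int * int)) : bool :=
  path lattice_step (0, 0) p && (last (0, 0) p == (n%:Z, y)).

Definition positive_lattice_paths (n : nat) : set (seq (int * int)) :=
  [set p | exists2 y : int, 0 < y & is_lattice_path n y p]%classic.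

(* Main.v *)
Require Import Defs.
From mathcomp Require Import all_boot all_order all_algebra.
From mathcomp Require Import classical_sets functions.
From mathcomp Require Import zify.

(* Write s = 2k + 1. The beta-set of a partition (its first-column hook lengths)
   turns the a-core condition into closure under subtraction of a, and distinct
   parts into the absence of consecutive elements. On an abacus with s runners
   an (s, s+2)-core with distinct parts is therefore a vector of bead counts
   n_0, ..., n_{s-1} with n_0 = 0, n_{i+2} <= n_i + 1, n_1 <= n_{s-1} + 2 and
   n_i n_{i+1} = 0. Reading the pairs (n_{2j}, n_{2j+1}) in order, these vectors
   are walks of k steps, and the number of walks from a given pair ending with
   n_{2k} >= c is a single binomial coefficient. Summing over n_1 gives the
   upper half of row s of Pascal's triangle, i.e. 2^(s-1), which is also the
   number of words of odd length s with more up than down steps. The bijection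
   matches enumerations of the two sets. *)

Set Implicit Arguments.
Unset Strict Implicit.
Unset Printing Implicit Defensive.

Import GRing.Theory Num.Theory.

Local Open Scope nat_scope.

(** * Hook lengths and beta-sets *)

Fixpoint beta (la : seq nat) : seq nat :=
  if la is x :: s then x + size s :: beta s else [::].

Fixpoint unbeta (t : seq nat) : seq nat :=
  if t is x :: u then x - size u :: unbeta u else [::].

(* For s weakly decreasing, gap s enumerates the complement of beta s. *)
Definition gap (s : seq nat) (j : nat) : nat := j + count (geq j) s.

Lemma ferrers_cons x s :
  ferrers (x :: s) =
    [seq (0, j) | j <- iota 0 x] ++ [seq (c.1.+1, c.2) | c <- ferrers s].
Proof.
rewrite /ferrers /= -[1]/(1 + 0) iotaDl allpairs_mapl; congr (_ ++ _).
by rewrite map_allpairs.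
Qed.

Lemma count_column s j :
  count (fun d : nat * nat => d.2 == j) (ferrers s) = count (ltn j) s.
Proof.
elim: s => // x s IHs; rewrite ferrers_cons count_cat !count_map /= -IHs.
congr (_ + _).
rewrite -(@eq_count _ (pred1 j)) // count_uniq_mem ?iota_uniq //.
by rewrite mem_iota.
Qed.

Lemma count_iota_gt j x : count (ltn j) (iota 0 x) = x - j.+1.
Proof.
elim: x => // x IHx; rewrite -addn1 iotaD count_cat IHx /=.
lia.
Qed.

(** The arm is [x - j - 1]; the leg counts the parts of [s] exceeding [j], that is [size s] minus
    the count inside [gap s j]. *)
Lemma hook_length_row0 x s j :
  j < x -> hook_length (x :: s) (0, j) = x + size s - gap s j.
Proof.
move=> ltjx;
  rewrite /hook_length /arm /leg ferrers_cons !count_cat !count_map /=.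
rewrite (@eq_count _ _ (ltn j)) // count_iota_gt.
rewrite (@eq_count _ _ pred0) // count_pred0.
rewrite (@eq_count _ _ pred0) ?count_pred0; last by move=> i /=; rewrite andbF.
rewrite (@eq_count _ _ (fun d : nat * nat => d.2 == j)); last first.
  by move=> d /=; rewrite andbT.
rewrite count_column /gap -(count_predC (geq j) s).
rewrite (@eq_count _ (predC (geq j)) (ltn j)) /=; last by move=> v /=; lia.
lia.
Qed.

Lemma hook_length_rowS x s i j :
  hook_length (x :: s) (i.+1, j) = hook_length s (i, j).
Proof.
rewrite /hook_length /arm /leg ferrers_cons !count_cat !count_map /=.
congr (_ + _ + _).
  by rewrite (@eq_count _ _ pred0) // count_pred0.
by rewrite (@eq_count _ _ pred0) ?count_pred0 // => d /=; rewrite andbF.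
Qed.

Lemma is_core_cons a x s :
  is_core a (x :: s) =
    all (fun j => ~~ (a %| x + size s - gap s j)) (iota 0 x) && is_core a s.
Proof.
rewrite /is_core ferrers_cons all_cat !all_map; congr (_ && _).
  apply: eq_in_all => j; rewrite mem_iota => /= ltjx.
  by rewrite hook_length_row0.
by apply: eq_all => -[i j] /=; rewrite hook_length_rowS.
Qed.

Lemma beta_lt x s y : path geq x s -> y \in beta s -> y < x + size s.
Proof.
elim: s x => // v s IHs x /= /andP[lexv ps]; rewrite inE => /predU1P[->|].
  by move: lexv => /=; lia.
by move/(IHs _ ps); move: lexv => /=; lia.
Qed.

Lemma sorted_beta s : sorted geq s -> sorted gtn (beta s).
Proof.
elim: s => // x s IHs /= pxs; rewrite path_sortedE; last first.
  by move=> ? ? ? /=; lia.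
by rewrite IHs ?(path_sorted pxs) // andbT; apply/allP => y /(beta_lt pxs).
Qed.

Lemma gap_all s j : all (geq j) s -> gap s j = j + size s.
Proof. by rewrite /gap all_count => /eqP->. Qed.

Lemma path_all_le x s j : path geq x s -> x <= j -> all (geq j) s.
Proof.
rewrite path_sortedE; last by move=> ? ? ? /=; lia.
by case/andP => /allP h _ lexj; apply/allP => y /h /=; lia.
Qed.

(** A head [v <= j] puts the gap above the whole beta-set; a head [v > j] leaves the gap unchanged
    and below [v + size s]. *)
Lemma gap_notin_beta s j : sorted geq s -> gap s j \notin beta s.
Proof.
elim: s => // v s IHs /= pvs.
have [levj|ltjv] := leqP v j.
  have jall := path_all_le pvs levj.
  rewrite gap_all /= ?levj // inE negb_or; apply/andP; split; first lia.
  by apply/negP => /(beta_lt pvs); lia.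
have gapE : gap (v :: s) j = gap s j by rewrite /gap /=; lia.
rewrite inE negb_or gapE IHs ?(path_sorted pvs) // andbT.
by rewrite /gap; have := count_size (geq j) s; lia.
Qed.

Lemma notin_beta_gap s y :
  sorted geq s -> y \notin beta s -> exists j, y = gap s j.
Proof.
elim: s => [|v s IHs] /= pvs; first by move=> _; exists y; rewrite /gap /=; lia.
rewrite inE negb_or => /andP[neqy ynot].
have [j def_y] := IHs (path_sorted pvs) ynot.
have [ltjv|levj] := ltnP j v; first by exists j; rewrite def_y /gap /=; lia.
have jall := path_all_le pvs levj.
(* The witness is [j - 1]: as [y = j + size s] differs from [v + size s], still [v <= j - 1], and
   the head adds one to the count. *)
rewrite gap_all // in def_y; exists (y - (size s).+1).
rewrite gap_all /=; first lia.
apply/andP; split; first by lia.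
by apply: (path_all_le pvs); lia.
Qed.

(** The hooks in the row with first-column hook [x] are the differences [x - y], where [y < x] is
    missing from the beta-set; [gap] runs through these [y]. *)
Lemma is_core_hooks a la : sorted geq la ->
  is_core a la <->
  {in beta la, forall x y, y < x -> y \notin beta la -> ~~ (a %| x - y)}.
Proof.
elim: la => [|x s IHs] /= pxs; first by split.
have [IH1 IH2] := IHs (path_sorted pxs); rewrite is_core_cons; split.
  case/andP => /allP row0 /IH1 core_s z; rewrite !inE => z_in y ltyz.
  rewrite inE negb_or => /andP[neqy ynot].
  case/predU1P: z_in => [zE|z_in]; last exact: core_s.
  have [j def_y] := notin_beta_gap (path_sorted pxs) ynot.
  rewrite zE def_y; apply: row0; rewrite mem_iota /= add0n ltnNge.
  apply/negP => lexj; move: def_y; rewrite gap_all; first by lia.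
  exact: (path_all_le pxs).
move=> hooks; apply/andP; split.
  apply/allP => j; rewrite mem_iota /= => ltjx.
  have lt_gap : gap s j < x + size s.
    by rewrite /gap; have := count_size (geq j) s; lia.
  apply: hooks => //; first by rewrite mem_head.
  by rewrite inE negb_or gap_notin_beta ?(path_sorted pxs) // andbT; lia.
apply: IH2 => z z_in y ltyz ynot; apply: hooks => //.
  by rewrite inE z_in orbT.
by rewrite inE negb_or ynot andbT; have := beta_lt pxs z_in; lia.
Qed.

(** If [x - a] were missing, [a] itself would be a hook length. Conversely, multiples of [a] are
    subtracted one [a] at a time. *)
Lemma is_coreP a la : 0 < a -> sorted geq la ->
  is_core a la <-> {in beta la, forall x, a <= x -> x - a \in beta la}.
Proof.
move=> a_gt0 /(is_core_hooks a) ->; split=> [hooks x x_in leax|closed x x_in y].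
  apply/negPn/negP => x_notin; have ltxa : x - a < x by lia.
  by have := hooks x x_in _ ltxa x_notin; rewrite subKn // dvdnn.
move=> ltyx ynot; apply/negP => /dvdnP[q def_q].
suff: x - q * a \in beta la.
  by rewrite -def_q subKn ?(ltnW ltyx) // (negPf ynot).
have: q * a <= x by rewrite -def_q leq_subr.
elim: q {def_q} => [|q IHq] le_qa; first by rewrite mul0n subn0.
rewrite mulSn addnC subnDA; apply: closed; last by lia.
by apply: IHq; lia.
Qed.

Lemma size_beta la : size (beta la) = size la.
Proof. by elim: la => //= x s ->. Qed.

Lemma size_unbeta t : size (unbeta t) = size t.
Proof. by elim: t => //= x s ->. Qed.

Lemma betaK : cancel beta unbeta.
Proof. by elim=> //= x s ->; rewrite size_beta addnK. Qed.

Lemma path_gtn_size x u : path gtn x u -> size u <= x.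
Proof. by elim: u x => //= y u IHu x /andP[/= ltyx /IHu]; lia. Qed.

Lemma unbetaK t : sorted gtn t -> beta (unbeta t) = t.
Proof.
elim: t => //= x u IHu pxu; rewrite IHu ?(path_sorted pxu) // size_unbeta.
by rewrite subnK // path_gtn_size.
Qed.

Lemma sorted_unbeta t : sorted gtn t -> sorted geq (unbeta t).
Proof.
elim: t => //= x [|y u] //= IHu /andP[/= ltyx pyu].
by rewrite IHu // andbT; lia.
Qed.

(** The smallest element of the beta-set is the last part itself. *)
Lemma all_pos_beta la : sorted geq la -> all (ltn 0) la = (0 \notin beta la).
Proof.
elim: la => // x s IHs /= pxs.
have {}IHs := IHs (path_sorted pxs); rewrite inE negb_or -IHs.
case: x pxs => [|x] pxs //.
case: s pxs IHs => //= y s /andP[/= + _].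
by case: y => [|y] //= _ <-; rewrite andbF.
Qed.

(** Neighbouring elements of the beta-set differ by one more than the corresponding parts, so equal
    parts give consecutive integers. *)
Lemma uniq_beta la : sorted geq la ->
  uniq la <-> {in beta la, forall x, x.+1 \notin beta la}.
Proof.
elim: la => [|x s IHs] /= pxs; first by split.
have [IH1 IH2] := IHs (path_sorted pxs); split.
  case/andP => x_notin /IH1 noconsec z; rewrite !inE negb_or.
  case/predU1P => [->|z_in].
    by rewrite eqn_leq ltnn /=; apply/negP => /(beta_lt pxs); lia.
  rewrite noconsec // andbT.
  case: s pxs x_notin z_in {IHs IH1 IH2 noconsec} =>
    // y s /= /andP[/= leyx pys].
  rewrite !inE negb_or => /andP[neqxy _] /predU1P[->|/(beta_lt pys)]; lia.
move=> noconsec; apply/andP; split; last first.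
  apply: IH2 => z z_in; have := noconsec z; rewrite !inE z_in orbT => /(_ isT).
  by case/norP.
case: s pxs noconsec {IHs IH1 IH2} => // y s /= /andP[/= leyx pys] noconsec.
rewrite inE negb_or; apply/andP; split.
  have := noconsec (y + size s); rewrite !inE eqxx orbT => /(_ isT).
  by rewrite negb_or => /andP[+ _]; lia.
have := noconsec (y + size s); rewrite !inE eqxx orbT => /(_ isT).
rewrite negb_or => /andP[neq _].
have ltyx : y < x by move: neq; lia.
apply/negP => x_in; have /allP/(_ x x_in) := path_all_le pys (leqnn y).
by rewrite /= leqNgt ltyx.
Qed.

(** * Counting walks *)

(* A state (e, o) stands for the levels of two consecutive residues 2j, 2j+1; at
   most one of them is nonzero. *)
Definition next_states (t : nat * nat) : seq (nat * nat) :=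
  if t.2 == 0 then (0, 1) :: [seq (i, 0) | i <- iota 0 t.1.+2]
  else [seq (0, i) | i <- iota 0 t.2.+2].

(** The two bounds express closure under subtraction of [s + 2], the two products the absence of
    consecutive elements. *)
Definition state_step (t u : nat * nat) : bool :=
  [&& u.1 <= t.1.+1, u.2 <= t.2.+1, t.2 * u.1 == 0 & u.1 * u.2 == 0].

Lemma mem_next_states t u :
  t.1 * t.2 = 0 -> (u \in next_states t) = state_step t u.
Proof.
case: t u => [a b] [i j] /= ab0; rewrite /next_states /state_step;
  cbn [fst snd].
apply/idP/idP.
  case: ifP => [/eqP b0|b_neq0].
    rewrite inE => /predU1P[[-> ->]|]; first by lia.
    by case/mapP => i'; rewrite mem_iota => /andP[_ lti] [-> ->]; lia.
  by case/mapP => i'; rewrite mem_iota => /andP[_ lti] [-> ->]; lia.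
case/and4P => lei lej bi ij; case: ifP => [/eqP b0|b_neq0].
  have [j0|j1] : j = 0 \/ j = 1 by lia.
    by rewrite j0 inE; apply/orP; right; apply: map_f; rewrite mem_iota; lia.
  by rewrite j1 (_ : i = 0) ?mem_head //; lia.
by rewrite (_ : i = 0) ?map_f ?mem_iota //; lia.
Qed.

Lemma uniq_next_states t : uniq (next_states t).
Proof.
rewrite /next_states; case: ifP => _.
  rewrite cons_uniq map_inj_uniq ?iota_uniq ?andbT; last by move=> ? ? [].
  by apply/mapP => -[].
by rewrite map_inj_uniq ?iota_uniq //; move=> ? ? [].
Qed.

(** The second level of the last pair belongs to the absent residue [s], hence must vanish. *)
Definition ends_above (c : nat) (t : nat * nat) := (t.2 == 0) && (c <= t.1).

Fixpoint state_paths (m c : nat) (t : nat * nat) : seq (seq (nat * nat)) :=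
  if m is m'.+1 then
    [seq u :: p | u <- next_states t, p <- state_paths m' c u]
  else if ends_above c t then [:: [::]] else [::].

Lemma mem_state_paths m c t p : t.1 * t.2 = 0 ->
  (p \in state_paths m c t) =
    [&& size p == m, path state_step t p & ends_above c (last t p)].
Proof.
elim: m t p => [|m IHm] t p t0 /=.
  by case: p => [|u p] /=; case: ifP => h; rewrite ?inE.
apply/allpairsPdep/idP.
  case=> u [q] [u_in q_in ->] /=; move: u_in; rewrite mem_next_states // => tu.
  by rewrite tu eqSS -IHm //; case/and4P: tu => _ _ _ /eqP.
case: p => [|u p] //= /and3P[sz /andP[tu pu] lst]; exists u, p.
have u0 : u.1 * u.2 = 0 by case/and4P: tu => _ _ _ /eqP.
by rewrite mem_next_states // IHm // pu -eqSS sz.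
Qed.

Lemma uniq_state_paths m c t : uniq (state_paths m c t).
Proof.
elim: m t => [|m IHm] t /=; first by case: ifP.
apply: allpairs_uniq_dep => //; first exact: uniq_next_states.
by move=> [u p] [u' p'] _ _ /= [-> ->].
Qed.

Definition npaths m c t := size (state_paths m c t).

Lemma npathsS m c t :
  npaths m.+1 c t = \sum_(u <- next_states t) npaths m c u.
Proof. by rewrite /npaths /= size_allpairs_dep sumnE big_map. Qed.

Lemma npathsSl m c a :
  npaths m.+1 c (a, 0) =
    npaths m c (0, 1) + \sum_(0 <= i < a.+2) npaths m c (i, 0).
Proof.
by rewrite npathsS /next_states eqxx big_cons big_map /index_iota subn0.
Qed.

Lemma npathsSr m c b :
  npaths m.+1 c (0, b.+1) = \sum_(0 <= i < b.+3) npaths m c (0, i).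
Proof. by rewrite npathsS /next_states big_map /index_iota subn0. Qed.

(** Both formulas are proved together by induction on [m], then on the starting level, through
    Pascal's rule. The guard matters only for [m = 0], where truncated subtraction would give
    ['C(0, 0) = 1]. *)
Lemma npathsE m c :
  (forall a, npaths m c (a, 0) = if c <= m + a then 'C(2 * m + a - c, m) else 0)
  /\ (forall b, npaths m c (0, b.+1) = 'C(2 * m + b - c, m + b.+1)).
Proof.
elim: m => [|m [IHl IHr]].
  split=> [a|b]; rewrite /npaths /= /ends_above /=; first by
    case: ifP; rewrite ?bin0.
  by rewrite bin_small //; lia.
split; elim=> [|a IHa].
- rewrite npathsSl 2?big_nat_recl // big_geq //= !IHl IHr !addn0.
  case: (leqP c m) => [lecm|ltmc].
    have [-> ->] : c <= m + 1 /\ c <= m.+1 by lia.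
    have ->: 2 * m.+1 - c = (2 * m - c).+2 by lia.
    have ->: 2 * m + 1 - c = (2 * m - c).+1 by lia.
    by rewrite addn1 !binS; lia.
  rewrite bin_small ?add0n; last by lia.
  case: (leqP c (m + 1)) => lec; last first.
    by have ->: c <= m.+1 = false by lia.
  (* Boundary case: a single walk, climbing at every step, reaches level [c]. *)
  have ->: c = m.+1 by lia.
  have ->: 2 * m + 1 - m.+1 = m by lia.
  have ->: 2 * m.+1 - m.+1 = m.+1 by lia.
  by rewrite leqnn !binn.
(* Passing from [a] to [a + 1] adds the single successor [(a + 2, 0)], so the recursion becomes
   Pascal's rule. *)
- rewrite npathsSl big_nat_recr //= addnA -npathsSl IHa IHl.
  case: (leqP c (m + a.+2)) => lec; last first.
    have ->: c <= m.+1 + a = false by lia.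
    by have ->: c <= m.+1 + a.+1 = false by lia.
  have ->: c <= m.+1 + a.+1 by lia.
  have ->: 2 * m.+1 + a.+1 - c = (2 * m + a.+2 - c).+1 by lia.
  rewrite binS; case: (leqP c (m.+1 + a)) => lec'.
    by congr ('C(_, _) + _); lia.
  by rewrite (@bin_small _ m.+1) //; lia.
- rewrite npathsSr 3?big_nat_recl // big_geq //= !IHl !IHr !addn0.
  case: (leqP c m) => [lecm|ltmc]; last by rewrite !bin_small //; lia.
  have ->: 2 * m.+1 - c = (2 * m - c).+2 by lia.
  have ->: 2 * m + 1 - c = (2 * m - c).+1 by lia.
  by rewrite addn1 addn2 addSn addn1 [RHS]binS [in RHS]addnC
    [X in _ = X + _]binS; lia.
- rewrite npathsSr big_nat_recr //= -npathsSr IHa IHr.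
  case: (leqP c (2 * m + a.+2)) => lec; last by rewrite !bin_small //; lia.
  have ->: 2 * m.+1 + a.+1 - c = (2 * m + a.+2 - c).+1 by lia.
  have ->: 2 * m.+1 + a - c = 2 * m + a.+2 - c by lia.
  by rewrite !addnS !addSn binS addnC.
Qed.

(** An odd row has no middle entry, so its two halves mirror each other and share the total
    equally. *)
Lemma sum_upper_half_bin k :
  \sum_(k.+1 <= i < k.*2.+2) 'C(k.*2.+1, i) = 2 ^ k.*2.
Proof.
have total : \sum_(0 <= i < k.*2.+2) 'C(k.*2.+1, i) = 2 * 2 ^ k.*2.
  rewrite -expnS -[2]/(1 + 1) expnDn big_mkord.
  by apply: eq_bigr => i _; rewrite !exp1n !muln1.
have lekk : k.+1 <= k.*2.+2 by lia.
rewrite (big_cat_nat (leq0n k.+1) lekk) /= in total.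
suff lower : \sum_(0 <= i < k.+1) 'C(k.*2.+1, i)
             = \sum_(k.+1 <= i < k.*2.+2) 'C(k.*2.+1, i) by lia.
rewrite [LHS]big_nat_rev /= -[in RHS](add0n k.+1) big_addn.
rewrite (_ : k.*2.+2 - k.+1 = k.+1); last by lia.
rewrite !big_mkord; apply: eq_bigr => i _; have := ltn_ord i => lti.
rewrite -bin_sub; last by lia.
by congr 'C(_, _); lia.
Qed.

(* b is the level of residue 1, and b - 2 (truncated) the least admissible
   level of residue 2k. *)
Definition abaci (k : nat) : seq (seq (nat * nat)) :=
  [seq (0, b) :: p | b <- iota 0 k.+3, p <- state_paths k (b - 2) (0, b)].

Lemma uniq_abaci k : uniq (abaci k).
Proof.
apply: allpairs_uniq_dep => [|b _|]; rewrite ?iota_uniq ?uniq_state_paths //.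
by move=> [b p] [b' p'] _ _ /= [-> ->].
Qed.

(** The values [b = 0] and [b = 1] have the same bound [b - 2 = 0] and merge into
    ['C(k.*2.+1, k.+1)]; each [b >= 2] gives ['C(k.*2.+1, k + b)]. *)
Lemma size_abaci k : size (abaci k) = 2 ^ k.*2.
Proof.
rewrite /abaci size_allpairs_dep sumnE big_map.
have ->: \sum_(b <- iota 0 k.+3) size (state_paths k (b - 2) (0, b))
         = \sum_(0 <= b < k.+3) npaths k (b - 2) (0, b).
  by rewrite /index_iota subn0.
have [_ npathsr] := npathsE k 0; have [npathsl _] := npathsE k 0.
rewrite 2?big_nat_recl // npathsl npathsr addn0 leq0n addnA !subn0 !addn0.
rewrite -sum_upper_half_bin [in RHS]big_ltn; last by lia.
congr (_ + _); first by rewrite addn1 mul2n binS addnC.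
rewrite -[in RHS](add0n k.+2) big_addn (_ : k.*2.+2 - k.+2 = k); last by lia.
(* The extreme value [b = k + 2] lies beyond the end of the row and contributes 0. *)
rewrite big_nat_recr //= [X in _ + X](_ : _ = 0) ?addn0; last first.
  have [_ ->] := npathsE k (k.+2 - 2); rewrite bin_small //; lia.
rewrite !big_mkord; apply: eq_bigr => i _.
by have [_ ->] := npathsE k (i.+2 - 2); congr 'C(_, _); lia.
Qed.

(** * Cores as abaci *)

(** Closure under subtraction of [s] leaves no hole on a runner, so one count per residue determines
    the beads. *)
Definition abacus (s : nat) (n : nat -> nat) (x : nat) : bool :=
  x %/ s < n (x %% s).

(** All beads lie below [s] times the largest level; the scan is reversed because [unbeta] reads a
    decreasing list. *)
Definition abacus_partition (s : nat) (n : nat -> nat) : seq nat :=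
  unbeta [seq x <- rev (iota 0 (s * \max_(i < s) n i)) | abacus s n x].

Lemma abacusE s n i m : i < s -> abacus s n (m * s + i) = (m < n i).
Proof.
move=> ltis; have s_gt0 : 0 < s by lia.
by rewrite /abacus divnMDl // modnMDl divn_small // modn_small // addn0.
Qed.

Lemma sorted_gtn_filter_rev_iota (P : pred nat) N :
  sorted gtn [seq x <- rev (iota 0 N) | P x].
Proof.
apply: sorted_filter; first by move=> ? ? ? /=; lia.
by rewrite rev_sorted; exact: iota_ltn_sorted.
Qed.

Lemma beta_abacus s n x : 0 < s ->
  (x \in beta (abacus_partition s n)) = abacus s n x.
Proof.
move=> s_gt0; rewrite unbetaK ?sorted_gtn_filter_rev_iota //.
rewrite mem_filter mem_rev mem_iota /= add0n.
case abx: (abacus s n x) => //=; rewrite mulnC -ltn_divLR //.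
have ltxs : x %% s < s by rewrite ltn_mod.
exact: (leq_trans abx (leq_bigmax (Ordinal ltxs))).
Qed.

Lemma abacus_partition_ext s n n' : (forall i, i < s -> n i = n' i) ->
  abacus_partition s n = abacus_partition s n'.
Proof.
case: s => [|s] eq_n; first by rewrite /abacus_partition !mul0n.
rewrite /abacus_partition (eq_bigr (fun i : 'I_s.+1 => n' i)); last first.
  by move=> i _; exact: eq_n.
congr unbeta; apply: eq_filter => x.
by rewrite /abacus eq_n // ltn_mod.
Qed.

Lemma abacus_partition_inj s n n' : 0 < s ->
  abacus_partition s n = abacus_partition s n' ->
  forall i, i < s -> n i = n' i.
Proof.
move=> s_gt0 eq_n i ltis.
have ltE m : (m < n i) = (m < n' i).
  by rewrite -!(@abacusE s) // -!beta_abacus // eq_n.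
by have := ltE (n i); have := ltE (n' i); rewrite !ltnn; lia.
Qed.

(* The level n s of the absent residue s is set to 0, so that the conditions
   on n (s - 2), n s and on n (s - 1), n s hold vacuously. *)
Definition core_levels (k : nat) (n : nat -> nat) : Prop :=
  [/\ n 0 = 0, n k.*2.+1 = 0,
      forall i, i.+1 < k.*2.+1 -> n i.+2 <= (n i).+1,
      forall i, i < k.*2.+1 -> n i * n i.+1 = 0
    & n 1 <= n k.*2 + 2].

Lemma core_abacus_partition k n : core_levels k n ->
  core_distinct k.*2.+1 (k.*2.+1 + 2) (abacus_partition k.*2.+1 n).
Proof.
rewrite /core_levels; move def_s: k.*2.+1 => s [n0 ns nSS nS n1].
have s_gt0 : 0 < s by lia.
have geq_la : sorted geq (abacus_partition s n).
  exact: sorted_unbeta (sorted_gtn_filter_rev_iota _ _).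
have xE x : x = x %/ s * s + x %% s by exact: divn_eq.
have lt_mod x : x %% s < s by rewrite ltn_mod.
split.
- rewrite /is_partition geq_la all_pos_beta // beta_abacus //.
  by rewrite -[0]/(0 * s + 0) abacusE // n0.
- apply/is_coreP => // x; rewrite !beta_abacus // (xE x).
  move: (x %/ s) (x %% s) (lt_mod x) => m i ltis; rewrite abacusE // => ltm les.
  have ->: m * s + i - s = m.-1 * s + i by case: m ltm les => [|m] ? ?; lia.
  by rewrite abacusE //; lia.
- apply/is_coreP => //; first by lia.
  move=> x; rewrite !beta_abacus // (xE x).
  move: (x %/ s) (x %% s) (lt_mod x) => m i ltis; rewrite abacusE // => ltm les.
  case: i ltis ltm les => [|[|i]] ltis ltm les; first by rewrite n0 in ltm.
    (* From residue 1, subtracting [s + 2] wraps around to residue [s - 1 = k.*2], two rows down. *)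
    have ->: m * s + 1 - (s + 2) = (m - 2) * s + k.*2.
      case: m ltm les => [|[|m]] ? ?; [lia|lia|].
      by rewrite !mulSn subSS subSS subn0; lia.
    by rewrite abacusE //; case: m ltm les => [|[|m]] ? ?; lia.
  have ->: m * s + i.+2 - (s + 2) = m.-1 * s + i.
    by case: m ltm les => [|m] ? ?; [lia | rewrite mulSn; lia].
  have := nSS i (ltnW ltis); rewrite abacusE; last by lia.
  by case: m ltm les => [|m] ? ?; lia.
- apply/uniq_beta => // x; rewrite !beta_abacus // (xE x).
  move: (x %/ s) (x %% s) (lt_mod x) => m i ltis; rewrite abacusE // => ltm.
  have [lti|lei] := ltnP i.+1 s.
    by rewrite -addnS abacusE //; have := nS i ltis; case: (n i) ltm; lia.
  (* The successor of the last residue wraps to residue 0, whose runner is empty. *)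
  have ->: (m * s + i).+1 = m.+1 * s + 0 by rewrite mulSn; lia.
  by rewrite abacusE // n0.
Qed.

(** The level of a runner is its first row without a bead. A violated inequality would let
    subtraction of [s + 2] move a bead onto such a row. *)
Lemma abacus_partition_core k la :
  core_distinct k.*2.+1 (k.*2.+1 + 2) la ->
  exists2 n, core_levels k n & la = abacus_partition k.*2.+1 n.
Proof.
rewrite /core_levels; move def_s: k.*2.+1 => s.
case=> /andP[geq_la pos_la] core_s core_s2 uniq_la.
have s_gt0 : 0 < s by lia.
have s2_gt0 : 0 < s + 2 by lia.
have{core_s} sub_s := (is_coreP s_gt0 geq_la).1 core_s.
have{core_s2} sub_s2 := (is_coreP s2_gt0 geq_la).1 core_s2.
have{uniq_la} noS := (uniq_beta geq_la).1 uniq_la.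
rewrite all_pos_beta // in pos_la.
have ex_out i : exists m, m * s + i \notin beta la.
  exists (\max_(x <- beta la) x).+1; apply/negP => out.
  have /= := @leq_bigmax_seq _ (beta la) xpredT id _ out isT.
  by rewrite leqNgt (leq_trans (leq_pmulr _ s_gt0) (leq_addr _ _)).
pose n i := if i < s then ex_minn (ex_out i) else 0.
have nE i m : i < s -> (m * s + i \in beta la) = (m < n i).
  move=> ltis; rewrite /n ltis; case: ex_minnP => u u_out u_min.
  have [ltmu|leum] := ltnP m u.
    by apply: contraLR ltmu => /u_min; rewrite -leqNgt.
  (* A bead in a row [m >= u] would descend by repeated subtraction of [s] to the missing row
     [u]. *)
  apply: contraNF u_out => m_in; rewrite -(subKn leum).
  elim: (m - u) (leq_subr u m) => [|d IHd] led; first by rewrite subn0.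
  have := IHd (ltnW led); rewrite (_ : m - d = (m - d.+1).+1); last by lia.
  rewrite mulSn -addnA => /sub_s; rewrite addKn; apply; exact: leq_addr.
have n0 : n 0 = 0 by apply/eqP; rewrite -leqn0 leqNgt -nE.
have ns : n s = 0 by rewrite /n ltnn.
exists n; first split=> //.
- move=> i ltis; rewrite leqNgt; apply/negP => gap_n.
  have [ltiSS|leiSS] := ltnP i.+2 s; last first.
    by move: gap_n; rewrite (_ : i.+2 = s) ?ns //; lia.
  rewrite -nE // in gap_n; have := sub_s2 _ gap_n.
  have ->: (n i).+1 * s + i.+2 - (s + 2) = n i * s + i by rewrite mulSn; lia.
  rewrite nE ?ltnn; last by lia.
  by move=> absurd; apply/notF/absurd; rewrite mulSn; lia.
- move=> i ltis; have [lti|lei] := ltnP i.+1 s; last first.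
    by rewrite (_ : i.+1 = s) ?ns ?muln0 //; lia.
  apply/eqP; rewrite muln_eq0 !eqn0Ngt -!nE // !mul0n !add0n.
  by rewrite -negb_and; apply/negP => /andP[/noS/negPf->].
- rewrite leqNgt; apply/negP => gap_n; case: (posnP k) => [k0|k_gt0].
    (* For [k = 0], residue 1 is the absent residue [s], of level 0. *)
    by move: gap_n; rewrite (_ : 1 = s) ?ns // -def_s k0.
  rewrite -nE in gap_n; last by lia.
  have := sub_s2 _ gap_n.
  have ->: (n k.*2 + 2) * s + 1 - (s + 2) = n k.*2 * s + k.*2.
    by rewrite addn2 !mulSn; lia.
  rewrite nE ?ltnn; last by lia.
  by move=> absurd; apply/notF/absurd; rewrite [n _ + 2]addn2 !mulSn; lia.
apply: (can_inj betaK); rewrite unbetaK ?sorted_gtn_filter_rev_iota //.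
apply: (@irr_sorted_eq _ gtn);
  rewrite ?sorted_gtn_filter_rev_iota ?sorted_beta //.
- by move=> ? ? ? /=; lia.
- by move=> ? /=; rewrite ltnn.
move=> x; rewrite -[in RHS](unbetaK (sorted_gtn_filter_rev_iota _ _)).
rewrite beta_abacus // {1}(divn_eq x s) nE ?ltn_mod //.
Qed.

(** * Level vectors read as walks on pairs *)

Definition levels (q : seq (nat * nat)) (i : nat) : nat :=
  let t := nth (0, 0) q i./2 in if odd i then t.2 else t.1.

Lemma levels_double q j : levels q j.*2 = (nth (0, 0) q j).1.
Proof. by rewrite /levels odd_double doubleK. Qed.

Lemma levels_doubleS q j : levels q j.*2.+1 = (nth (0, 0) q j).2.
Proof. by rewrite /levels /= odd_double /= uphalf_double. Qed.

Lemma parityP i : (exists j, i = j.*2) \/ (exists j, i = j.*2.+1).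
Proof.
by rewrite -[i]odd_double_half; case: (odd i); [right | left]; exists i./2.
Qed.

Lemma mem_abaci k q :
  q \in abaci k -> size q = k.+1 /\ core_levels k (levels q).
Proof.
case/allpairsPdep => b [p] [_ + ->]; rewrite mem_state_paths // => /and3P[].
move=> /eqP size_p /(pathP (0, 0)) steps /andP[/eqP last2 last1].
have step j : j < k -> state_step (nth (0, 0) ((0, b) :: p) j)
                         (nth (0, 0) ((0, b) :: p) j.+1).
  by rewrite -size_p; exact: steps.
have last_q : last (0, b) p = nth (0, 0) ((0, b) :: p) k.
  by rewrite -size_p -[size p]/(size ((0, b) :: p)).-1 nth_last.
rewrite last_q in last1 last2; split; first by rewrite /= size_p.
split.
- by [].
- by rewrite levels_doubleS.
- move=> i; case: (parityP i) => -[j ->] ltj;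
    have /step/and4P[le1 le2 _ _] : j < k by lia.
    by rewrite -doubleS !levels_double.
  by rewrite -doubleS !levels_doubleS.
- move=> i; case: (parityP i) => -[j ->] ltj.
    rewrite levels_double levels_doubleS; case: j ltj => [|j] ltj //.
    by have /step/and4P[_ _ _ /eqP] : j < k by lia.
  rewrite -doubleS levels_double levels_doubleS.
  by have /step/and4P[_ _ /eqP] : j < k by lia.
- have ->: levels ((0, b) :: p) 1 = b by [].
  by rewrite levels_double addnC -leq_subLR.
Qed.

Lemma core_levels_abaci k n : core_levels k n ->
  exists2 q, q \in abaci k & forall i, i < k.*2.+2 -> levels q i = n i.
Proof.
case=> n0 ns nSS nS n1; pose t j := (n j.*2, n j.*2.+1).
have [p def_q] : exists p, mkseq t k.+1 = (0, n 1) :: p.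
  by exists (behead (mkseq t k.+1)); rewrite /mkseq /= /t n0.
have size_p : size p = k by apply: succn_inj;
  rewrite -[RHS](size_mkseq t) def_q.
have nth_t j : j < k.+1 -> nth (0, 0) ((0, n 1) :: p) j = t j.
  by move=> ltj; rewrite -def_q nth_mkseq.
(* This bounds [n 1] by [k + 2], within the range enumerated in [abaci]. *)
have n_even j : j <= k -> n j.*2 <= j.
  elim: j => [|j IHj] ltj; first by rewrite n0.
  by apply: leq_trans (nSS j.*2 _) _; [lia | rewrite ltnS IHj // ltnW].
exists ((0, n 1) :: p).
  apply/allpairsPdep; exists (n 1), p; split=> //.
    by rewrite mem_iota; have := n_even k (leqnn k); lia.
  rewrite mem_state_paths // size_p eqxx /=; apply/andP; split.
    apply/(pathP (0, 0)) => j; rewrite size_p => ltj.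
    rewrite -[nth _ p j]/(nth (0, 0) ((0, n 1) :: p) j.+1) !nth_t //;
      last by lia.
    apply/and4P; split=> /=; [exact: nSS (j.*2) ltac:(lia) | | |].
    - by apply: (nSS j.*2.+1); lia.
    - by rewrite (nS j.*2.+1) //; lia.
    - by rewrite (nS j.+1.*2) //; lia.
  have ->: last (0, n 1) p = t k.
    by rewrite -nth_t // -size_p -[size p]/(size ((0, n 1) :: p)).-1 nth_last.
  by rewrite /ends_above /t /= ns leq_subLR addnC.
move=> i; case: (parityP i) => -[j ->] ltj.
  by rewrite levels_double nth_t //; lia.
by rewrite levels_doubleS nth_t //; lia.
Qed.

Lemma core_distinct_abaci k la :
  core_distinct k.*2.+1 (k.*2.+1 + 2) la <->
  la \in [seq abacus_partition k.*2.+1 (levels q) | q <- abaci k].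
Proof.
split=> [/abacus_partition_core[n /core_levels_abaci[q q_in eq_n] ->]|].
  by apply/mapP; exists q => //; apply: abacus_partition_ext => i lti;
    rewrite eq_n //; lia.
by case/mapP => q /mem_abaci[_ ok_q] ->; apply: core_abacus_partition.
Qed.

Lemma uniq_core_abaci k :
  uniq [seq abacus_partition k.*2.+1 (levels q) | q <- abaci k].
Proof.
rewrite map_inj_in_uniq ?uniq_abaci // => q q' /mem_abaci[sz [_ ns _ _ _]].
move=> /mem_abaci[sz' [_ ns' _ _ _]] /abacus_partition_inj eq_l.
apply: (@eq_from_nth _ (0, 0)); rewrite ?sz ?sz' // => j ltj.
have eq1 : (nth (0, 0) q j).1 = (nth (0, 0) q' j).1.
  by rewrite -!levels_double eq_l //; lia.
have eq2 : (nth (0, 0) q j).2 = (nth (0, 0) q' j).2.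
  rewrite -!levels_doubleS; have [ltjk|lekj] := ltnP j k;
    first by rewrite eq_l //; lia.
  (* The level of the absent residue is invisible in the partition, but is 0 on both sides. *)
  by rewrite (_ : j = k) ?ns ?ns' //; lia.
by rewrite [LHS]surjective_pairing eq1 eq2 -surjective_pairing.
Qed.

(** * Lattice paths *)

Fixpoint path_of_word (P : int * int) (w : seq bool) : seq (int * int) :=
  if w is u :: w' then
    let Q := (P + (1, if u then 1 else -1))%R in Q :: path_of_word Q w'
  else [::].

Lemma path_of_wordP P p :
  reflect (exists w, p = path_of_word P w) (path lattice_step P p).
Proof.
apply: (iffP idP) => [|[w ->]].
  elim: p P => [|Q p IHp] P /=; first by exists [::].
  case/andP => /orP[] /eqP-> /IHp[w ->]; [by exists (true :: w)|].
  by exists (false :: w).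
by elim: w P => //= u w IHw P; rewrite IHw /lattice_step; case: u;
  rewrite eqxx ?orbT.
Qed.

Lemma path_of_word_inj P : injective (path_of_word P).
Proof.
move=> w; elim: w P => [|u w IHw] P [|v w'] //= [] /= uv1 uv2 /=.
move: uv2; case: u v uv1 => [] [] /= uv1 => [/IHw->|||/IHw->] //; lia.
Qed.

Lemma last_path_of_word P w :
  last P (path_of_word P w) =
    (P.1 + (size w)%:Z, P.2 + (count id w)%:Z - (count negb w)%:Z)%R.
Proof.
elim: w P => [|u w IHw] [x y] /=; first by congr pair; lia.
by rewrite IHw /=; case: u => /=; congr pair; lia.
Qed.

Definition positive_word (w : seq bool) : bool := count negb w < count id w.

Definition positive_words (n : nat) : seq (n.-tuple bool) :=
  enum [pred w : n.-tuple bool | positive_word w].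

(** The final height is the number of up steps minus the number of down steps. *)
Lemma positive_lattice_paths_words n p :
  positive_lattice_paths n p <->
  p \in [seq path_of_word (0, 0)%R w | w : n.-tuple bool <- positive_words n].
Proof.
split=> [[y y_gt0 /andP[/path_of_wordP[w ->]]]|/mapP[w]].
  rewrite last_path_of_word /= => /eqP[size_w y_def].
  have size_wn : size w == n by apply/eqP; lia.
  apply/mapP; exists (Tuple size_wn) => //;
    rewrite mem_enum inE /positive_word /=.
  by move: y_gt0; rewrite -y_def; lia.
rewrite mem_enum inE /positive_word => w_pos ->.
exists ((count id w)%:Z - (count negb w)%:Z)%R;
  first by rewrite subr_gt0 ltz_nat.
rewrite /is_lattice_path last_path_of_word size_tuple /=.
apply/andP; split; first by apply/path_of_wordP; exists w.
by apply/eqP; congr pair; lia.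
Qed.

Lemma uniq_positive_paths n :
  uniq [seq path_of_word (0, 0)%R w | w : n.-tuple bool <- positive_words n].
Proof.
by rewrite map_inj_uniq ?enum_uniq // => w w' /path_of_word_inj/val_inj.
Qed.

(** Exchanging up and down steps swaps positive words with the others, since odd length excludes
    ties; so exactly half of all words are positive. *)
Lemma size_positive_words k : size (positive_words k.*2.+1) = 2 ^ k.*2.
Proof.
rewrite -cardE; set P := [pred w | _]; set s := k.*2.+1 in P *.
pose flip (w : s.-tuple bool) := map_tuple negb w.
have flipK : involutive flip.
  by move=> w; apply: val_inj; rewrite /= -map_comp map_id_in // => b _ /=;
    rewrite negbK.
have flip_pos : [preim flip of P] =i [predC P].
  move=> w; rewrite !inE /positive_word /= !count_map.
  rewrite (@eq_count _ (preim negb negb) id); last by move=> b /=;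
    rewrite negbK.
  rewrite (@eq_count _ (preim negb id) negb) //.
  by have := count_predC id w;
    rewrite size_tuple /s (@eq_count _ (predC id) negb) //; lia.
have := cardC P; rewrite -(eq_card flip_pos) card_preim //; last exact: inv_inj.
rewrite card_tuple card_bool /s expnS.
rewrite (@eq_card _ [predI codom flip & P] P).
  by rewrite addnn -mul2n => /eqP; rewrite eqn_pmul2l // => /eqP.
by move=> w; rewrite inE -{1}[w]flipK codom_f.
Qed.

(** Elements at equal positions of the two enumerations are matched; [y0] only makes [nth] total. *)
Lemma set_bij_seq (T U : eqType) (y0 : U) (r : seq T) (t : seq U)
    (A : set T) (B : set U) :
  uniq r -> uniq t -> size r = size t ->
  (forall x, A x <-> x \in r) -> (forall y, B y <-> y \in t) ->
  set_bij A B (fun x => nth y0 t (index x r)).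
Proof.
move=> uniq_r uniq_t eq_sz Ar Bt; split.
- by move=> x /Ar x_in; apply/Bt; rewrite mem_nth // -eq_sz index_mem.
- move=> x x' /set_mem/Ar x_in /set_mem/Ar x'_in /eqP.
  rewrite nth_uniq -?eq_sz ?index_mem // => /eqP eq_index.
  by rewrite -(nth_index x x_in) eq_index nth_index.
- move=> y /Bt y_in; have lt_y : index y t < size r by rewrite eq_sz index_mem.
  (* [T] might be empty, so the default for [nth] is drawn from [r], nonempty because [y] has a
     position below its size. *)
  have [x0 _] : exists x0, x0 \in r.
    by case: r lt_y {uniq_r eq_sz Ar} => // x0 r _; exists x0; rewrite mem_head.
  exists (nth x0 r (index y t)); first by apply/Ar; rewrite mem_nth.
  by rewrite index_uniq // nth_index.
Qed.

Theorem theorem1p1 (s : nat) (s_gt0 : (0 < s)%N) (s_odd : odd s) :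
  exists f : seq nat -> seq (int * int),
    set_bij (core_distinct s (s + 2)%N) (positive_lattice_paths s) f.
Proof.
have def_s : s = s./2.*2.+1 by rewrite -[LHS]odd_double_half s_odd.
rewrite {}def_s {s_gt0 s_odd}; move: s./2 => {s} k.
eexists; apply: (set_bij_seq [::] (uniq_core_abaci k)
                             (uniq_positive_paths k.*2.+1)).
- by rewrite size_map size_abaci [RHS]size_map size_positive_words.
- exact: core_distinct_abaci.
- exact: positive_lattice_paths_words.
Qed.
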